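(* In the stochastic-averaging setting of the context, assume (E.1) and (E.4), and let the weights be $\nu_k=\gamma_k^\alpha$ for each $k\in\mathbb N$, for some $\alpha\in]0,\tau[$, where $\tau$ is the Hölder exponent in (E.4). If the following conditions on $(\gamma_k)$ hold, $$\Big(\gamma_k^{1+\min\{\alpha/2,\ \tau-\alpha\}}\Big)_{k\in\mathbb N}\in\ell^1\qquad\text{and, for $k$ sufficiently large,}\qquad \frac{\gamma_k}{\gamma_{k+1}}\le1+o(\gamma_k^\alpha),$$ then the summability condition on the gradient error is satisfied; namely, the sequence $\big(\gamma_{k+1}\mathbb E[\|\lambda_{k+1}\|\mid\mathcal S_k]\big)_{k\in\mathbb N}$ belongs to $\ell^1(\mathfrak S)$, i.e. it is adapted to the filtration $\mathfrak S$ and almost surely summable.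
   Context: **Problem.** $\mathcal H$ is a real Hilbert space, $\mathcal C\subset\mathcal H$ is convex and weakly compact, $A$ is a bounded linear operator from $\mathcal H$ to a real Hilbert space, $b\in\operatorname{ran}A$, $\eta$ is a random variable, and the problem is $\min_{x\in\mathcal C,\ Ax=b} f(x)$ with $f(x)=\mathbb E[L(x,\eta)]$, where $L(\cdot,\eta)$ is differentiable for every $\eta$. (E.1) $\nabla f(x)=\mathbb E[\nabla_xL(x,\eta)]$ (almost surely). (E.4) $f$ is Hölder smooth with constant $C_f>0$ and exponent $\tau>0$: $\|\nabla f(x)-\nabla f(y)\|\le C_f\|x-y\|^\tau$ for all $x,y$. **Iteration (ICGALP for this problem).** With $x_0\in\mathcal C$, $\mu_0\in\operatorname{ran}A$, $z_k=\widehat\nabla f_k+A^*\mu_k+\rho_kA^*(Ax_k-b)$, $\widehat s_k\in\mathcal C$ a (possibly inexact, up to error $\lambda_k^s\ge0$) minimizer of $\langle z_k,\cdot\rangle$ over $\mathcal C$, $x_{k+1}=x_k-\gamma_k(x_k-\widehat s_k)$, $\mu_{k+1}=\mu_k+\theta_k(Ax_{k+1}-b)$, where $\gamma_k\in]0,1]$ and $\rho_k,\theta_k\ge0$. Filtration: $\mathfrak S=(\mathcal S_k)_{k\in\mathbb N}$, $\mathcal S_k=\sigma(x_0,\mu_0,\widehat s_0,\dots,\widehat s_k)$. The gradient is computed inexactly by the recursion $$\widehat\nabla f_k=(1-\nu_k)\widehat\nabla f_{k-1}+\nu_k\nabla_xL(x_k,\eta_k),\qquad \widehat\nabla f_{-1}=0,$$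 with weights $\nu_k\in[0,1]$ and the $\eta_k$ i.i.d. (with the distribution of $\eta$). The gradient error is $\lambda_k=\widehat\nabla f_k-\nabla f(x_k)$. **Standing step-size assumption.** There are constants $\underline M,\overline M>0$ with $\underline M\le\gamma_k/\gamma_{k+1}\le\overline M$ for all $k$.
   Formalization: The formal theorem additionally assumes E‖∇_xL(x,η)−∇f(x)‖² ≤ σ² uniformly for x in C (the claim fails for heavy-tailed η without it), and makes explicit that η_k is independent of the past and that ∇_xL is jointly measurable. *)

(* Defs.v *)
From HB Require Import structures.
From mathcomp Require Import all_boot all_order all_algebra.
From mathcomp Require Import finmap.
From mathcomp Require Import all_classical all_reals all_analysis.

Set Implicit Arguments.
Unset Strict Implicit.
Unset Printing Implicit Defensive.

Import Order.TTheory GRing.Theory Num.Theory.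
Import numFieldNormedType.Exports.

Local Open Scope classical_set_scope.
Local Open Scope ring_scope.

(** * Real Hilbert spaces *)

HB.mixin Record CompleteNormedModule_isHilbert (R : realType) V
    of CompleteNormedModule R V := {
  inner : V -> V -> R;
  innerC : forall x y, inner x y = inner y x;
  inner_linearl : forall a x y v, inner (a *: x + y) v = a * inner x v + inner y v;
  inner_norm : forall x, inner x x = `|x| ^+ 2
}.

#[short(type="hilbertType")]
HB.structure Definition Hilbert (R : realType) :=
  {V of CompleteNormedModule R V & CompleteNormedModule_isHilbert R V}.

Section hilbert.
Context {R : realType} {H K : hilbertType R}.

(** The weak topology is initial for [x |-> <x, .>] into [R ^ H] with the
    topology of pointwise convergence. *)
Definition weakly_compact (C : set H) : Prop :=
  compact (C : set (initial_topology (inner : H -> {ptws H -> R}))).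

Definition bounded_operator (A : H -> K) : Prop :=
  exists M : R, forall x, `|A x| <= M * `|x|.

Definition is_adjoint (A : H -> K) (B : K -> H) : Prop :=
  forall x y, inner (A x) y = inner x (B y).

(** [g] is the (Frechet) gradient of [f] at [x]: the Riesz representative of
    the differential. *)
Definition is_gradient (f : H -> R) (x g : H) : Prop :=
  differentiable f x /\ forall v, 'd f x v = inner g v.

End hilbert.

(** * Hilbert-space valued random variables

    Measurability is meant in the sense of Bochner, so that sums of random
    variables are random variables also when the space is not separable; on a
    separable space this is Borel measurability. *)

Section random_elements.
Context {R : realType} {H : hilbertType R}.

Definition is_simple d (T : measurableType d) (s : T -> H) : Prop :=
  finite_set (range s) /\ forall y, measurable (s @^-1` [set y]).

Definition strongly_measurable d (T : measurableType d) (X : T -> H) : Prop :=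
  exists s : nat -> T -> H,
    (forall n, is_simple (s n)) /\ forall t, s n t @[n --> \oo] --> X t.

Definition simple_expectation d (T : measurableType d) (P : probability T R)
    (s : T -> H) : H :=
  \sum_(y \in range s) fine (P (s @^-1` [set y])) *: y.

Definition is_bochner_expectation d (T : measurableType d)
    (P : probability T R) (X : T -> H) (v : H) : Prop :=
  strongly_measurable X /\
  exists s : nat -> T -> H,
    [/\ forall n, is_simple (s n),
        ('E_P[fun t => `|X t - s n t|%R] @[n --> \oo] --> 0)%E &
        simple_expectation P (s n) @[n --> \oo] --> v].

(** Joint measurability of [G : H * E -> H], tested on random variables. When
    [H] is separable this is measurability for the product of the Borel
    sigma-algebra and the one of [E] (take [T := H * E] and the projections). *)
Definition jointly_measurable d' (E : measurableType d') (G : H -> E -> H) : Prop :=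
  forall d (T : measurableType d) (X : T -> H) (Y : T -> E),
    strongly_measurable X -> measurable_fun setT Y ->
    strongly_measurable (fun t => G (X t) (Y t)).

End random_elements.

(** * Filtrations, independence, conditional expectation *)

Section probability.
Context {R : realType} {d : measure_display} {T : measurableType d}.
Variable P : probability T R.

Definition iid_copies d' (E : measurableType d') (eta : T -> E)
    (etas : nat -> T -> E) : Prop :=
  (forall k (B : set E), measurable B -> P (etas k @^-1` B) = P (eta @^-1` B)) /\
  (forall (I : {fset nat}) (B : nat -> set E), (forall i, measurable (B i)) ->
    P (\bigcap_(i in [set` I]) etas i @^-1` B i) =
    (\prod_(i <- I) P (etas i @^-1` B i))%E).

Definition independent_of d' (E : measurableType d') (F : set (set T))
    (Y : T -> E) : Prop :=
  forall (A : set T) (B : set E), F A -> measurable B ->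
    P (A `&` Y @^-1` B) = (P A * P (Y @^-1` B))%E.

(** [Z] is a version of [E[Y | G]], for a sigma-algebra [G] of events. *)
Definition is_cond_expectation (G : set (set T)) (Y Z : T -> R) : Prop :=
  [/\ P.-integrable setT (EFin \o Y),
      P.-integrable setT (EFin \o Z),
      forall B : set R, measurable B -> G (Z @^-1` B) &
      forall A, G A ->
        (\int[P]_(t in A) (Z t)%:E = \int[P]_(t in A) (Y t)%:E)%E].

(** [l^1] of a filtration: adapted and almost surely summable. *)
Definition ell1 (S : nat -> set (set T)) (r : nat -> T -> R) : Prop :=
  (forall k (B : set R), measurable B -> S k (r k @^-1` B)) /\
  {ae P, forall t, cvgn (series (fun k => `|r k t|))}.

End probability.

(** Preimages of open sets generate the same sigma-algebra as preimages of
    Borel sets. *)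

Definition event_generators (T : Type) (H K : topologicalType) (x0 : T -> H)
    (mu0 : T -> K) (s : nat -> T -> H) (k : nat) : set (set T) :=
  preimage_set_system setT x0 open `|` preimage_set_system setT mu0 open `|`
  \bigcup_(i in `I_k) preimage_set_system setT (s i) open.

(** [sigma (x_0, mu_0, s_0, .., s_k)] *)
Definition filtration (T : Type) (H K : topologicalType) (x0 : T -> H)
    (mu0 : T -> K) (s : nat -> T -> H) (k : nat) : set (set T) :=
  <<s event_generators x0 mu0 s k.+1 >>.

(** Everything known before step [k] draws its sample:
    [sigma (x_0, mu_0, s_0, .., s_{k-1}, eta_0, .., eta_{k-1})] *)
Definition past (T : Type) (H K : topologicalType) d (E : measurableType d)
    (x0 : T -> H) (mu0 : T -> K) (s : nat -> T -> H) (etas : nat -> T -> E)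
    (k : nat) : set (set T) :=
  <<s event_generators x0 mu0 s k `|`
      \bigcup_(i in `I_k) preimage_set_system setT (etas i) measurable >>.

(* Main.v *)
Require Import Defs.
From HB Require Import structures.
From mathcomp Require Import all_boot all_order all_algebra.
From mathcomp Require Import finmap.
From mathcomp Require Import all_classical all_reals all_analysis.
From mathcomp Require Import measurable_realfun ring lra.

Set Implicit Arguments.
Unset Strict Implicit.
Unset Printing Implicit Defensive.

Import Order.TTheory GRing.Theory Num.Theory.
Import numFieldNormedType.Exports.

Local Open Scope classical_set_scope.
Local Open Scope ring_scope.

(** The gradient error splits as
      [lambda k = (1 - nu k) V + nu k N],
    where [V = ghat (k - 1) - gradf (x k)] is known before the sample [etas k]
    is drawn, and [N = gradL (x k) (etas k) - gradf (x k)] has, given the past,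
    mean zero and second moment at most [sigma ^ 2].  The cross term of the
    square has expectation zero ([averaging_orthogonal]), so that
      [E |lambda k|^2 <= (1 - nu k)^2 E |V|^2 + (nu k)^2 sigma^2].

    The vector [V] differs from [lambda (k - 1)] by
    [gradf (x (k - 1)) - gradf (x k)].  A weakly compact set is bounded
    ([weakly_compact_bounded]) and the iterates stay in [C], so one step has
    length O([gamma k]) and this drift is O([gamma k `^ tau]) by Hoelder
    continuity.  Young's inequality with weight [nu k] then gives
    ([error_step], [source_term_le]), for [a k = E |lambda k|^2] and
    [m = min (alpha / 2) (tau - alpha)],
      [a (k + 1) <= (1 - nu (k + 1)) a k + c nu (k + 1) gamma (k + 1) `^ (2 m)].
    Because [gamma k / gamma (k + 1) <= 1 + o(nu k)], large multiples of
    [gamma k `^ (2 m)] are supersolutions of this recursion, hence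
    [a k] = O([gamma k `^ (2 m)]) ([recursion_bound]).  Therefore
    [gamma k * E |lambda k|] = O([gamma k `^ (1 + m)]) is summable.  Conditional
    expectation does not increase the L1 norm, so the series of the conditional
    expectations has finite expectation and converges almost surely
    ([ae_summable]).

    The cross term vanishes by Fubini's theorem: since [etas k] is independent
    of the past, the pair of a point of the sample space equipped with the past
    sigma-algebra and of [etas k] has a product law ([law_pair]), and the past
    can be frozen while the sample is averaged out ([freezing]).  This requires
    [x k] and [ghat (k - 1)] to be strongly measurable for the past itself and
    not only for the ambient sigma-algebra, which follows from Pettis'
    criterion ([strongly_measurable_pettis]). *)

(** * Geometry of a real Hilbert space *)

Section inner_product.
Context {R : realType} {H : hilbertType R}.
Implicit Types (u v w : H) (a : R).

Lemma inner0l v : inner 0 v = 0 :> R.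
Proof.
by have := inner_linearl 1 0 0 v; rewrite scaler0 addr0 mul1r => e; lra.
Qed.

Lemma innerDl u v w : inner (u + v) w = inner u w + inner v w.
Proof. by have := inner_linearl 1 u v w; rewrite scale1r mul1r. Qed.

Lemma innerZl a u w : inner (a *: u) w = a * inner u w.
Proof. by have := inner_linearl a u 0 w; rewrite addr0 inner0l addr0. Qed.

Lemma innerDr u v w : inner w (u + v) = inner w u + inner w v.
Proof. by rewrite innerC innerDl !(innerC w). Qed.

Lemma innerZr a u w : inner w (a *: u) = a * inner w u.
Proof. by rewrite innerC innerZl innerC. Qed.

Lemma innerBr u v w : inner w (u - v) = inner w u - inner w v.
Proof. by rewrite innerDr -scaleN1r innerZr mulN1r. Qed.

Lemma inner_is_linear w : linear (inner w : H -> R).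
Proof. by move=> a u v; rewrite innerDr innerZr. Qed.

Lemma normD_sqr u v : `|u + v| ^+ 2 = `|u| ^+ 2 + 2 * inner u v + `|v| ^+ 2.
Proof.
by rewrite -!inner_norm innerDl !innerDr (innerC v u); ring.
Qed.

Lemma inner_le_sqr u v : `|2 * inner u v| <= `|u| ^+ 2 + `|v| ^+ 2.
Proof.
have := normD_sqr u v; have := normD_sqr u (- v).
rewrite -scaleN1r innerZr normrZ normrN1 mul1r.
have := sqr_ge0 `|u + v|; have := sqr_ge0 `|u + -1 *: v|.
by rewrite ler_norml; lra.
Qed.

Lemma cauchy_schwarz u v : `|inner u v| <= `|u| * `|v|.
Proof.
have [->|u0] := eqVneq u 0; first by rewrite inner0l !normr0 mul0r.
have [->|v0] := eqVneq v 0; first by rewrite innerC inner0l !normr0 mulr0.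
have nu0 : 0 < `|u| by rewrite normr_gt0.
have nv0 : 0 < `|v| by rewrite normr_gt0.
have := inner_le_sqr (`|u|^-1 *: u) (`|v|^-1 *: v).
rewrite innerZl innerZr !normrZ !normfV !normr_id !mulVf ?gt_eqF// expr1n.
rewrite normr_nat -[1 + 1]mulr1 ler_pM2l//.
by rewrite mulrA -invfM mulrC ler_pdivrMr ?mulr_gt0// mul1r.
Qed.

Lemma inner_continuous v : continuous (inner v : H -> R).
Proof.
move=> u; apply/cvgrPdist_lt => e e0.
near=> w.
rewrite -innerBr (le_lt_trans (cauchy_schwarz _ _))//.
have v1 : 0 < `|v| + 1 by rewrite ltr_wpDl.
rewrite (@le_lt_trans _ _ ((`|v| + 1) * `|u - w|))//.
  by rewrite ler_wpM2r// lerDl.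
rewrite mulrC -ltr_pdivlMr//.
near: w; apply/nbhs_normP; exists (e / (`|v| + 1)); first exact: divr_gt0.
by [].
Unshelve. all: by end_near. Qed.

Lemma normD_young (t : R) u v : 0 < t ->
  `|u + v| ^+ 2 <= (1 + t) * `|u| ^+ 2 + (1 + t^-1) * `|v| ^+ 2.
Proof.
move=> t0; have tN0 : t != 0 by rewrite gt_eqF.
have := le_trans (ler_norm _) (inner_le_sqr (t *: u) v).
rewrite innerZl (_ : `|t *: u| = t * `|u|); last first.
  by rewrite normrZ ger0_norm ?ltW.
rewrite normD_sqr -subr_ge0 => h; rewrite -subr_ge0.
rewrite (_ : _ - _ =
  t^-1 * ((t * `|u|) ^+ 2 + `|v| ^+ 2 - 2 * (t * inner u v))); last by field.
by apply: mulr_ge0 => //; rewrite invr_ge0 ltW.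
Qed.

(** A weakly compact set is pointwise bounded as a set of functionals
    [<c, .>], hence bounded by the uniform boundedness principle. *)
Lemma weakly_compact_bounded (C : set H) : weakly_compact C ->
  exists M : R, forall c, C c -> `|c| <= M.
Proof.
move=> wC.
pose F := [set (inner c : H -> R^o) | c in C].
have Fb : pointwise_bounded (F : set (H -> R^o)).
  move=> v.
  have cv : continuous (fun c : initial_topology (inner : H -> {ptws H -> R}) =>
      inner c v : R^o).
    move=> c.
    have := @initial_continuous _ _ (inner : H -> {ptws H -> R}) c.
    move=> /(@continuous_comp _ _ _ _ (fun g : {ptws H -> R} => g v : R^o)).
    apply.
    exact: (@proj_continuous H (fun=> R^o) v).
  have /compact_bounded := continuous_compact (continuous_subspaceT cv) wC.
  move=> [M [_ /(_ (M + 1))]]; rewrite ltrDl ltr01 => /(_ isT) h.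
  by exists (M + 1) => _ [c Cc <-]; apply: h; exists c.
have [M hM] : exists M, forall f, F f -> forall x, `|x| <= 1 -> `|f x| <= M.
  apply: (@Banach_Steinhauss R H R^o F _ Fb) => _ [c _ <-].
  split; last exact: inner_is_linear.
  move=> r; exists (`|c| * r) => x xr.
  by rewrite (le_trans (cauchy_schwarz _ _))// ler_wpM2l.
exists M => c Cc.
have [->|c0] := eqVneq c 0.
  rewrite normr0 (le_trans _ (hM _ (ex_intro2 _ _ c Cc erefl) 0 _)) ?normr0 //.
have nc : `|c| != 0 by rewrite normr_eq0.
have := hM _ (ex_intro2 _ _ c Cc erefl) (`|c|^-1 *: c).
rewrite normrZ normfV normr_id mulVf// => /(_ (lexx _)).
by rewrite innerZr inner_norm expr2 mulrA mulVf// mul1r normr_id.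
Qed.

End inner_product.

(** * Strong measurability *)

Section simple.
Context {R : realType} {H : hilbertType R} d (T : measurableType d).

Lemma simple_preimage (s : T -> H) (A : set H) :
  is_simple s -> measurable (s @^-1` A).
Proof.
move=> [sfin sm].
rewrite (_ : s @^-1` A = \bigcup_(y in range s `&` A) s @^-1` [set y]).
  apply: fin_bigcup_measurable => [|y _]; last exact: sm.
  exact: finite_setIl.
apply/seteqP; split => t /=; first by move=> At; exists (s t) => //; split => //; exists t.
by move=> [y [_ Ay] /= ->].
Qed.

Lemma simple_cst (v : H) : is_simple (cst v : T -> H).
Proof.
split; first by apply: (@sub_finite_set _ _ [set v]) => [_ [t _ <-]|].
by move=> y; rewrite preimage_cst; case: ifP.
Qed.

Lemma simple_measurable d' (U : measurableType d') (g : H -> U) (s : T -> H) :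
  is_simple s -> measurable_fun setT (g \o s).
Proof.
by move=> ss _ B _; rewrite setTI comp_preimage; exact: simple_preimage.
Qed.

End simple.

Section simple2.
Context {R : realType} {H K V : hilbertType R} d (T : measurableType d).

Lemma simple_comp2 (g : H -> K -> V) (s : T -> H) (u : T -> K) :
  is_simple s -> is_simple u -> is_simple (fun t => g (s t) (u t)).
Proof.
move=> ss su; split.
  have : finite_set [set g y z | y in range s & z in range u].
    by apply: finite_image2; [case: ss|case: su].
  apply: sub_finite_set => _ [t _ <-].
  by exists (s t); [exists t|exists (u t) => //; exists t].
move=> y.
rewrite (_ : _ @^-1` _ = \bigcup_(a in range s)
   (s @^-1` [set a] `&` u @^-1` [set b | g a b = y])).
  apply: fin_bigcup_measurable => [|a _]; first by case: ss.
  by apply: measurableI; [exact: simple_preimage ss|exact: simple_preimage su].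
apply/seteqP; split => t /=.
  by move=> gy; exists (s t); [exists t|].
by move=> [a _ [-> /=]].
Qed.

End simple2.

Section strongly_measurable_continuous.
Context {R : realType} {H K : hilbertType R} d (T : measurableType d).

Lemma strongly_measurable_continuous (g : H -> K) (X : T -> H) :
  continuous g -> strongly_measurable X -> strongly_measurable (g \o X).
Proof.
move=> cg [s [ss sX]]; exists (fun n => g \o s n); split.
  by move=> n; exact: (simple_comp2 (fun x (_ : H) => g x) (ss n) (ss n)).
by move=> t; apply: continuous_cvg; [exact: cg|exact: sX].
Qed.

End strongly_measurable_continuous.

Section strong_measurability.
Context {R : realType} {H : hilbertType R} d (T : measurableType d).

Lemma strongly_measurable_cst (v : H) : strongly_measurable (cst v : T -> H).
Proof.
by exists (fun=> cst v); split => [n|t]; [exact: simple_cst|exact: cvg_cst].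
Qed.

Lemma strongly_measurableD (X Y : T -> H) :
  strongly_measurable X -> strongly_measurable Y ->
  strongly_measurable (fun t => X t + Y t).
Proof.
move=> [s [ss sX]] [u [su uY]]; exists (fun n t => s n t + u n t); split.
  by move=> n; exact: (simple_comp2 (fun x y => x + y)).
by move=> t; exact: cvgD.
Qed.

Lemma strongly_measurableZ (a : R) (X : T -> H) :
  strongly_measurable X -> strongly_measurable (fun t => a *: X t).
Proof. by apply: strongly_measurable_continuous; exact: scaler_continuous. Qed.

Lemma strongly_measurableB (X Y : T -> H) :
  strongly_measurable X -> strongly_measurable Y ->
  strongly_measurable (fun t => X t - Y t).
Proof.
move=> mX mY; under eq_fun do rewrite -(scaleN1r (Y _)).
by apply: strongly_measurableD => //; exact: strongly_measurableZ.
Qed.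

Lemma strongly_measurable_comp d' (T' : measurableType d') (phi : T' -> T)
    (X : T -> H) : measurable_fun setT phi ->
  strongly_measurable X -> strongly_measurable (X \o phi).
Proof.
move=> mphi [s [ss sX]]; exists (fun n => s n \o phi); split => [n|t]; last first.
  exact: sX.
split.
  by apply: (@sub_finite_set _ _ (range (s n))) => [_ [t _ <-]|]; [exists (phi t)|case: (ss n)].
move=> y; rewrite comp_preimage -[X in measurable X]setTI.
by apply: mphi => //; exact: (ss n).2.
Qed.

Lemma measurable_norm (X : T -> H) :
  strongly_measurable X -> measurable_fun setT (fun t => `|X t|).
Proof.
move=> [s [ss sX]].
apply: (@measurable_fun_cvg _ _ _ _ (fun n t => `|s n t|)).
  by move=> n; exact: (simple_measurable (fun x => `|x|)).
by move=> t _; apply: cvg_norm; exact: sX.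
Qed.

Lemma measurable_inner (X Y : T -> H) :
  strongly_measurable X -> strongly_measurable Y ->
  measurable_fun setT (fun t => inner (X t) (Y t)).
Proof.
move=> mX mY.
(* polarization *)
rewrite (_ : (fun _ => _) = fun t =>
    2^-1 * (`|X t + Y t| ^+ 2 - `|X t| ^+ 2 - `|Y t| ^+ 2)); last first.
  by apply/funext => t; rewrite normD_sqr; field.
apply: measurable_funM => //; apply: measurable_funB; last first.
  exact/measurable_funX/measurable_norm.
apply: measurable_funB; apply: measurable_funX; apply: measurable_norm => //.
exact: strongly_measurableD.
Qed.

(** A point [X t] lies in [U] iff, for some radius, the approximations [s n t]
    eventually lie in [U] together with the ball of that radius around them; the
    preimage becomes a countable combination of level sets of simple
    functions. *)
Lemma strongly_measurable_open (X : T -> H) (U : set H) :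
  strongly_measurable X -> open U -> measurable (X @^-1` U).
Proof.
move=> [s [ss sX]] oU.
pose Um m := [set y | forall z, `|y - z| < m.+1%:R^-1 -> U z].
rewrite (_ : X @^-1` U =
    \bigcup_m \bigcup_N \bigcap_(n in [set n | (N <= n)%N]) s n @^-1` (Um m)).
  apply: bigcupT_measurable => m; apply: bigcupT_measurable => N.
  by apply: bigcap_measurableType => n _; exact: simple_preimage.
apply/seteqP; split => t /=.
  move=> Ut; have /nbhs_normP[e /= e0 eU] : nbhs (X t) U by exact: open_nbhs_nbhs.
  have /ltr_add_invr[m] : 0 < e / 2 by rewrite divr_gt0.
  rewrite add0r => me.
  have /cvgrPdist_lt/(_ (e / 2)) := sX t.
  rewrite divr_gt0// => /(_ isT)[N _ hN].
  exists m => //; exists N => // n /= Nn z zs; apply: eU => /=.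
  rewrite -(subrKA (s n t)) (le_lt_trans (ler_normD _ _))// [ltRHS]splitr.
  by apply: ltrD; [exact: hN|exact: lt_trans me].
move=> [m _ [N _ hN]].
have /cvgrPdist_lt/(_ m.+1%:R^-1) := sX t.
rewrite invr_gt0 ltr0Sn => /(_ isT)[N' _ hN'].
apply: (hN (maxn N N')); first by rewrite /= leq_maxl.
by rewrite distrC; apply: hN' => /=; exact: leq_maxr.
Qed.

Lemma strongly_measurable_separable (X : T -> H) : strongly_measurable X ->
  exists e : nat -> H, forall t eps, 0 < eps -> exists i, `|X t - e i| < eps.
Proof.
move=> [s [ss sX]].
have [q qE] : {q : nat -> seq H & forall n, range (s n) = [set` q n]}.
  apply: (@choice _ _ (fun n q => range (s n) = [set` q])) => n.
  by apply/finite_seqP; case: (ss n).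
exists (fun k => if choice.unpickle k is Some (n, j) then nth 0 (q n) j else 0).
move=> t eps e0; have /cvgrPdist_lt/(_ eps e0)[N _ hN] := sX t.
have : [set` q N] (s N t) by rewrite -qE; exists t.
move=> /= sq; exists (choice.pickle (N, index (s N t) (q N))).
by rewrite choice.pickleK nth_index//; apply: hN => /=.
Qed.

Fixpoint nearest (e : nat -> H) (n : nat) (x : H) : H :=
  if n is m.+1 then
    if `|x - e n| < `|x - nearest e m x| then e n else nearest e m x
  else e 0%N.

(** Pettis' criterion: [X] is approximated by its nearest point among
    [e 0, .., e n], whose distance to [X] decreases to zero because the [e i]
    are dense in the range of [X]. *)
Lemma strongly_measurable_pettis (X : T -> H) (e : nat -> H) :
  (forall U, open U -> measurable (X @^-1` U)) ->
  (forall t eps, 0 < eps -> exists i, `|X t - e i| < eps) ->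
  strongly_measurable X.
Proof.
move=> mX eX.
pose s n t := nearest e n (X t).
have s_le n i t : (i <= n)%N -> `|X t - s n t| <= `|X t - e i|.
  rewrite /s; elim: n => [|n IH] /=; first by rewrite leqn0 => /eqP ->.
  rewrite leq_eqVlt => /predU1P[->|]; first by case: ltP.
  by rewrite ltnS => /IH h; case: ltP => // /ltW/le_trans; apply.
have s_range n : range (s n) `<=` e @` `I_n.+1.
  elim: n => [|n IH] _ [t _ <-]; first by exists 0%N.
  rewrite /s /=; case: ltP => _; first by exists n.+1 => //=.
  have [i /= ni ie] := IH (s n t) (ex_intro2 _ _ t I erefl).
  by exists i; [exact: ltnW|exact: ie].
have s_simple n : is_simple (s n).
  split; first by apply: (sub_finite_set (@s_range n)); apply: finite_image; exact: finite_II.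
  elim: n => [|n IH] y.
    by rewrite [s _]/(cst (e 0%N)) preimage_cst; case: ifP.
  have mlt (a b : H) : measurable [set t | `|X t - a| < `|X t - b|].
    apply: (mX [set z | `|z - a| < `|z - b|]).
    have -> : [set z | `|z - a| < `|z - b|] = (fun z => `|z - b| - `|z - a|) @^-1` [set r | 0 < r].
      by apply/seteqP; split => z /=; rewrite subr_gt0.
    apply: open_comp; last exact: open_gt.
    move=> z _; apply: cvgB; apply: cvg_norm; apply: cvgB; try exact: cvg_id; exact: cvg_cst.
  have mD : measurable [set t | `|X t - e n.+1| < `|X t - s n t|].
    rewrite (_ : mkset _ = \bigcup_(i in `I_n.+1)
      (s n @^-1` [set e i] `&` [set t | `|X t - e n.+1| < `|X t - e i|])).
      apply: fin_bigcup_measurable => [|i _]; first exact: finite_II.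
      by apply: measurableI; [exact: IH|exact: mlt].
    apply/seteqP; split => t /=.
      move=> h; have [i ii ie] := s_range n (s n t) (ex_intro2 _ _ t I erefl).
      by exists i => //; split; rewrite /= ie.
    by move=> [i _ [/= -> ]].
  rewrite (_ : _ @^-1` _ =
    ([set t | `|X t - e n.+1| < `|X t - s n t|] `&` cst (e n.+1) @^-1` [set y]) `|`
    (~` [set t | `|X t - e n.+1| < `|X t - s n t|] `&` s n @^-1` [set y])).
    apply: measurableU; apply: measurableI => //; last exact: measurableC.
    by rewrite preimage_cst; case: ifP.
  have sS t : s n.+1 t =
    if `|X t - e n.+1| < `|X t - s n t| then e n.+1 else s n t by [].
  apply/seteqP; split => t; rewrite /= sS.
    by case: (boolP (_ < _)) => [h <-|/negP h <-]; [left|right].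
  by move=> [[h <-]|[/negP h <-]]; [rewrite ifT|rewrite (negbTE h)].
exists s; split => // t.
apply/cvgrPdist_lt => eps e0.
have [i hi] := eX t _ e0.
by exists i => // n /= ni; apply: le_lt_trans hi; exact: s_le.
Qed.

End strong_measurability.

Section strong_measurability_sub.
Context {R : realType} {H : hilbertType R} d (T : measurableType d).

(** The approximating simple functions need not be measurable for the smaller
    sigma-algebra, but separability of the range does not depend on the
    sigma-algebra, and Pettis' criterion rebuilds suitable ones. *)
Lemma strongly_measurable_sub (G : set (set T)) (X : T -> H) :
  strongly_measurable X -> (forall U, open U -> <<s G >> (X @^-1` U)) ->
  strongly_measurable (X : g_sigma_algebraType G -> H).
Proof.
move=> /strongly_measurable_separable[e eX] GX.
exact: (@strongly_measurable_pettis R H _ (g_sigma_algebraType G) X e GX eX).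
Qed.

End strong_measurability_sub.

(** * Bochner expectations against a fixed vector *)

Section bochner.
Context {R : realType} {H : hilbertType R} d (T : measurableType d).
Variable P : probability T R.

Lemma simple_inner_integrable (s : T -> H) (u : H) : is_simple s ->
  P.-integrable setT (fun t => (inner u (s t))%:E).
Proof.
move=> ss; apply: measurable_bounded_integrable => //.
- by have := fin_num_measure P setT measurableT; rewrite ge0_fin_numE.
- exact: (simple_measurable (inner u)).
- have /compact_bounded[M [Mreal hM]] : compact [set inner u y | y in range s].
    by apply: finite_compact; apply: finite_image; case: ss.
  exists M; split => // N /hM h t _; apply: h.
  by exists (s t) => //; exists t.
Qed.

Lemma simple_inner_expectation (s : T -> H) (u : H) : is_simple s ->
  (\int[P]_t (inner u (s t))%:E = (inner u (simple_expectation P s))%:E)%E.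
Proof.
move=> ss; have [sfin sm] := ss.
rewrite /simple_expectation fsbig_finite//=.
pose F y t := ((inner u y)%:E * (\1_(s @^-1` [set y]) t)%:E)%E.
transitivity (\int[P]_t (\sum_(y <- fset_set (range s)) F y t))%E.
  apply: eq_integral => t _.
  have st : s t \in fset_set (range s) by rewrite in_fset_set// inE; exists t.
  rewrite (bigD1_seq (s t)) ?fset_uniq//= {1}/F indicE mem_set//= mule1 big1 ?adde0// => y yt.
  by rewrite /F indicE memNset ?mule0//= => ty; rewrite ty eqxx in yt.
rewrite integral_sum//; last first.
  by move=> y; apply: integrableZl => //; apply: integrable_indic.
rewrite (big_morph _ (fun x y => innerDr x y u) (_ : _ = 0)); last first.
  by rewrite innerC inner0l.
rewrite -sumEFin; apply: eq_bigr => y _.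
rewrite integralZl//; last exact: integrable_indic.
by rewrite integral_indic// setIT innerZr mulrC EFinM fineK// fin_num_measure.
Qed.

(** Pairing with [u] is linear and bounded by [`|u|], so it passes to the L1
    limit that defines the Bochner expectation.  This turns unbiasedness of the
    stochastic gradient into a statement on scalar integrals, to which Fubini's
    theorem applies. *)
Lemma bochner_expectation_inner (X : T -> H) (v u : H) :
  is_bochner_expectation P X v ->
  P.-integrable setT (fun t => (inner u (X t))%:E) /\
  (\int[P]_t (inner u (X t))%:E = (inner u v)%:E)%E.
Proof.
move=> [mX [s [ss Es sv]]].
have ms n : strongly_measurable (s n).
  by exists (fun=> s n); split => // t; exact: cvg_cst.
have mXs n : measurable_fun setT (fun t => `|X t - s n t|).
  exact/measurable_norm/strongly_measurableB.
have miX : measurable_fun setT (fun t => inner u (X t)).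
  by apply: measurable_inner => //; exact: strongly_measurable_cst.
have miXs n : measurable_fun setT (fun t => inner u (X t - s n t)).
  apply: measurable_inner; first exact: strongly_measurable_cst.
  exact: strongly_measurableB.
have [Efin Ecvg] : (\forall n \near \oo, ('E_P[fun t => `|X t - s n t|%R])%E \is a fin_num) /\
    (fine ('E_P[fun t => `|X t - s n t|%R])%E @[n --> \oo] --> (0:R)).
  by move/fine_cvgP : Es.
have iXs n : ('E_P[fun t => `|X t - s n t|%R])%E \is a fin_num ->
    P.-integrable setT (fun t => (inner u (X t - s n t))%:E).
  rewrite unlock => fn; have : P.-integrable setT (fun t => (`|u| * `|X t - s n t|)%:E).
    apply: (@integrableZl _ _ _ _ _ _ `|u| (fun t => (`|X t - s n t|)%:E)) => //.
    apply/integrableP; split; first exact/measurable_EFinP.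
    by rewrite integral_fin_num_abs.
  apply: le_integrable => //; first exact/measurable_EFinP.
  move=> t _; rewrite !abse_EFin lee_fin normrM !normr_id.
  exact: cauchy_schwarz.
have innerX n t : inner u (X t) = inner u (X t - s n t) + inner u (s n t).
  by rewrite -innerDr subrK.
have iX : P.-integrable setT (fun t => (inner u (X t))%:E).
  have [N _ hN] := Efin.
  under eq_fun do rewrite (innerX N) EFinD.
  apply: integrableD => //; last exact: simple_inner_integrable.
  by apply: iXs; apply: hN => /=.
split => //.
rewrite -(fineK (integrable_fin_num _ iX))//; congr EFin.
apply: (@cvg_unique R^o _
  ((fun n => inner u (simple_expectation P (s n))) @ \oo)) => //; last first.
  by apply: continuous_cvg => //; exact: inner_continuous.
apply/cvgrPdist_lt => e e0.
have u1 : 0 < `|u| + 1 by rewrite ltr_wpDl.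
move/cvgrPdist_lt : Ecvg => /(_ (e / (`|u| + 1))).
rewrite divr_gt0// => /(_ isT); apply: filterS2 Efin => n fn.
rewrite sub0r normrN => En.
rewrite -lte_fin.
have -> : ((`|fine (\int[P]_x (inner u (X x))%:E) - inner u (simple_expectation P (s n))|)%:E
   = `| \int[P]_t (inner u (X t - s n t))%:E |)%E.
  rewrite -abse_EFin EFinB fineK ?integrable_fin_num// -simple_inner_expectation//.
  rewrite -integralB_EFin//; last exact: simple_inner_integrable.
  by congr (`| _ |)%E; apply: eq_integral => t _; rewrite (innerX n) EFinD addeK.
apply: (le_lt_trans (le_abse_integral _ _ _)) => //; first exact/measurable_EFinP.
apply: (@le_lt_trans _ _ (\int[P]_t (`|u|%:E * (`|X t - s n t|)%:E))%E).
  apply: ge0_le_integral => //.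
  - by apply: measurableT_comp => //; exact/measurable_EFinP.
  - by apply: measurable_funeM; exact/measurable_EFinP.
  - by move=> t _; rewrite -EFinM abse_EFin lee_fin cauchy_schwarz.
rewrite ge0_integralZl//; last exact/measurable_EFinP.
move: En fn; rewrite unlock => En fn.
rewrite -(fineK fn) -EFinM lte_fin.
have E0 : 0 <= fine (\int[P]_t (`|X t - s n t|)%:E)%E.
  by apply: fine_ge0; apply: integral_ge0 => t _; rewrite lee_fin.
rewrite ger0_norm// in En.
rewrite (@le_lt_trans _ _ ((`|u| + 1) * fine (\int[P]_t (`|X t - s n t|)%:E)%E))//.
  by rewrite ler_wpM2r// lerDl.
by rewrite mulrC -ltr_pdivlMr.
Qed.

End bochner.

(** * Freezing the past *)

Section freezing.
Context {R : realType} d (T : measurableType d) d' (E : measurableType d').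
Variables (P : probability T R) (G : set (set T)).
Hypothesis GT : <<s G >> `<=` measurable.
Variables (eta Y : T -> E).
Hypotheses (meta : measurable_fun setT eta) (mY : measurable_fun setT Y).
Hypothesis Yeta : forall B, measurable B -> P (Y @^-1` B) = P (eta @^-1` B).
Hypothesis YG : independent_of P <<s G >> Y.

Local Notation TG := (g_sigma_algebraType G).

Lemma measurable_id_sub : measurable_fun setT (id : T -> TG).
Proof. by move=> _ B mB; rewrite setTI; exact: GT. Qed.

Let idG : {mfun T >-> TG} := mfun_Sub (mem_set measurable_id_sub).
Let etaE : {mfun T >-> E} := mfun_Sub (mem_set meta).

Let mpair : measurable_fun setT (fun t => (t, Y t) : TG * E).
Proof. by apply/measurable_fun_pairP; split => //; exact: measurable_id_sub. Qed.

Let pairGE : {mfun T >-> (TG * E)%type} := mfun_Sub (mem_set mpair).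

(** By independence the pair [(t, Y t)] is distributed as the product of the
    restriction of [P] to [<<s G >>] and the law of [eta]. *)
Lemma law_pair (A : set (TG * E)) : measurable A ->
  (distribution P idG \x distribution P etaE)%E A = distribution P pairGE A.
Proof.
move=> mA; apply: product_measure_unique => //= B D mB mD.
by rewrite /distribution /pushforward/= -Yeta// -YG.
Qed.

(** Tonelli's theorem on the product law: a bound that holds for each frozen
    past holds on average. *)
Lemma ge0_freezing_le (f : TG * E -> \bar R) (M : R) :
  measurable_fun setT f -> (forall z, (0 <= f z)%E) ->
  (forall t, \int[P]_u f (t, eta u) <= M%:E)%E ->
  (\int[P]_t f (t, Y t) <= M%:E)%E.
Proof.
move=> mf f0 fM.
have -> : (\int[P]_t f (t, Y t) = \int[distribution P pairGE]_z f z)%E.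
  by rewrite ge0_integral_distribution.
have -> : (\int[distribution P pairGE]_z f z =
    \int[distribution P idG \x distribution P etaE]_z f z)%E.
  by apply: eq_measure_integral => A mA _; apply/esym; exact: law_pair.
rewrite fubini_tonelli1//.
apply: (@le_trans _ _ (\int[distribution P idG]_t M%:E)%E).
  apply: ge0_le_integral => //.
  - by move=> t _; apply: integral_ge0.
  - exact: measurable_fun_fubini_tonelli_F.
  - move=> t _; rewrite /fubini_F ge0_integral_distribution//; first exact: fM.
    exact: measurableT_comp.
rewrite integral_cst// [X in (_ * X)%E](_ : _ = 1%E) ?mule1//.
exact: probability_setT.
Qed.

(** Fubini's theorem on the product law.  The sections are required to be
    integrable at every [t], not merely at almost every one, so that the inner
    integral is the expectation over [eta] without exceptional sets. *)
Lemma freezing (f : TG * E -> \bar R) : measurable_fun setT f ->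
  P.-integrable setT (fun t => f (t, Y t)) ->
  (forall t, P.-integrable setT (fun u => f (t, eta u))) ->
  (\int[P]_t f (t, Y t) = \int[P]_t \int[P]_u f (t, eta u))%E.
Proof.
move=> mf intf intft.
transitivity (\int[distribution P pairGE]_z f z)%E.
  by rewrite integral_distribution.
have iprod : (distribution P idG \x distribution P etaE)%E.-integrable setT f.
  apply/integrableP; split => //.
  rewrite (eq_measure_integral (distribution P pairGE)); last first.
    by move=> A mA _; exact: law_pair.
  rewrite ge0_integral_distribution//; last exact: measurableT_comp.
  by case/integrableP: intf.
transitivity (\int[distribution P idG \x distribution P etaE]_z f z)%E.
  by apply: eq_measure_integral => A mA _; apply/esym; exact: law_pair.
have FE t : (\int[distribution P etaE]_y f (t, y) = \int[P]_u f (t, eta u))%E.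
  rewrite integral_distribution//; first exact: measurableT_comp.
  exact: intft.
rewrite -integral12_prod_meas1//.
transitivity (\int[distribution P idG]_t \int[P]_u f (t, eta u))%E.
  by apply: eq_integral => t _; exact: FE.
have mF : measurable_fun setT (fun t : TG => \int[P]_u f (t, eta u))%E.
  apply: (eq_measurable_fun (fubini_F (distribution P etaE) f)) => [t _|].
    exact: FE.
  exact: measurable_fubini_F iprod.
rewrite integral_distribution//.
have := integrable_fubini_F iprod.
move=> /integrableP[_ Foo]; apply/integrableP; split.
  by apply: measurableT_comp => //; exact: measurable_id_sub.
move: Foo; rewrite ge0_integral_distribution//; last first.
  by apply: measurableT_comp => //; exact: measurable_fubini_F iprod.
by under eq_integral do rewrite /= /fubini_F FE.
Qed.

End freezing.

(** * One averaging step *)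

Section averaging.
Context {R : realType} {H : hilbertType R}.
Context d (T : measurableType d) d' (E : measurableType d').
Variables (P : probability T R) (G : set (set T)).
Hypothesis GT : <<s G >> `<=` measurable.
Variables (eta Y : T -> E).
Hypotheses (meta : measurable_fun setT eta) (mY : measurable_fun setT Y).
Hypothesis Yeta : forall B, measurable B -> P (Y @^-1` B) = P (eta @^-1` B).
Hypothesis YG : independent_of P <<s G >> Y.
Variables (C : set H) (gradL : H -> E -> H) (gradf : H -> H) (sigma : R).
Hypothesis gradL_meas : jointly_measurable gradL.
Hypothesis gradf_cont : continuous gradf.
Hypothesis gradf_expectation :
  forall x, is_bochner_expectation P (fun t => gradL x (eta t)) (gradf x).
Hypothesis variance : forall x, C x ->
  ('E_P[fun t => (`|gradL x (eta t) - gradf x| ^+ 2)%R] <= (sigma ^+ 2)%:E)%E.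

Local Notation TG := (g_sigma_algebraType G).

Variables (X V : TG -> H).
Hypotheses (mX : strongly_measurable X) (mV : strongly_measurable V).
Hypothesis CX : forall t, C (X t).

Let N (z : TG * E) := gradL (X z.1) z.2 - gradf (X z.1).

Let mN : strongly_measurable N.
Proof.
have m1 : measurable_fun setT (fst : TG * E -> TG) by exact: measurable_fst.
have mX1 : strongly_measurable (fun z : TG * E => X z.1).
  exact: (strongly_measurable_comp m1 mX).
apply: strongly_measurableB; last exact: (strongly_measurable_continuous gradf_cont).
by apply: gradL_meas => //; exact: measurable_snd.
Qed.

Let mV1 : strongly_measurable (fun z : TG * E => V z.1).
Proof.
have m1 : measurable_fun setT (fst : TG * E -> TG) by exact: measurable_fst.
exact: (strongly_measurable_comp m1 mV).
Qed.

Let mpair : measurable_fun setT (fun t => (t, Y t) : TG * E).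
Proof. by apply/measurable_fun_pairP; split => //; exact: measurable_id_sub. Qed.

Let N_sqr : (\int[P]_t (`|N (t, Y t)| ^+ 2)%:E <= (sigma ^+ 2)%:E)%E.
Proof.
have mN2 : measurable_fun setT (fun z => (`|N z| ^+ 2)%:E).
  by apply/measurable_EFinP/measurable_funX/measurable_norm.
apply: (ge0_freezing_le GT meta mY Yeta YG mN2) => [z|t].
  by rewrite lee_fin sqr_ge0.
by have := variance (CX t); rewrite unlock.
Qed.

(** Frozen at [t], the cross term is the pairing of the constant [V t] with
    [gradL (X t) eta - gradf (X t)], which has mean zero. *)
Lemma averaging_orthogonal : (\int[P]_t (`|V t| ^+ 2)%:E < +oo)%E ->
  P.-integrable setT (fun t => (2 * inner (V t) (N (t, Y t)))%:E) /\
  (\int[P]_t (2 * inner (V t) (N (t, Y t)))%:E = 0)%E.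
Proof.
move=> Voo.
have mVT : strongly_measurable (V : T -> H).
  exact: (strongly_measurable_comp (measurable_id_sub GT) mV).
have mNT : strongly_measurable (fun t => N (t, Y t)).
  exact: (strongly_measurable_comp mpair mN).
have iV : P.-integrable setT (fun t => (`|V t| ^+ 2)%:E).
  apply/integrableP; split; first exact/measurable_EFinP/measurable_funX/measurable_norm.
  by under eq_integral do rewrite gee0_abs ?lee_fin ?sqr_ge0//.
have iN : P.-integrable setT (fun t => (`|N (t, Y t)| ^+ 2)%:E).
  apply/integrableP; split; first exact/measurable_EFinP/measurable_funX/measurable_norm.
  under eq_integral do rewrite gee0_abs ?lee_fin ?sqr_ge0//.
  exact: le_lt_trans N_sqr (ltry _).
have iVN : P.-integrable setT (fun t => (2 * inner (V t) (N (t, Y t)))%:E).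
  apply: (le_integrable _ _ _ (integrableD measurableT iV iN)) => //.
    exact/measurable_EFinP/measurable_funM/measurable_inner.
  move=> t _; rewrite -EFinD !abse_EFin lee_fin.
  by apply: le_trans (inner_le_sqr _ _) _; rewrite ler_norm.
split => //.
have mf : measurable_fun setT (fun z : TG * E => (2 * inner (V z.1) (N z))%:E).
  exact/measurable_EFinP/measurable_funM/measurable_inner.
have section0 t : P.-integrable setT (fun u => (2 * inner (V t) (N (t, eta u)))%:E) /\
    (\int[P]_u (2 * inner (V t) (N (t, eta u)))%:E = 0)%E.
  have [ig Ig] := bochner_expectation_inner (V t) (gradf_expectation (X t)).
  have NE : (fun u => (2 * inner (V t) (N (t, eta u)))%:E) = (fun u =>
    2%:E * ((inner (V t) (gradL (X t) (eta u)))%:E - (inner (V t) (gradf (X t)))%:E))%E.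
    by apply/funext => u; rewrite -EFinB -EFinM -innerBr.
  have ic : P.-integrable setT (fun=> (inner (V t) (gradf (X t)))%:E).
    exact: finite_measure_integrable_cst.
  rewrite NE; split.
    by apply: integrableZl => //; exact: integrableB.
  rewrite integralZl//; last exact: integrableB.
  by rewrite integralB// Ig integral_cst//= probability_setT mule1 subee// mule0.
rewrite (freezing GT meta mY Yeta YG mf iVN (fun t => (section0 t).1)).
by under eq_integral do rewrite (section0 _).2; rewrite integral0.
Qed.

(** Pythagoras' identity for a past term and an orthogonal noise term. *)
Lemma averaging_step (s a : R) :
  (\int[P]_t (`|V t| ^+ 2)%:E <= a%:E)%E ->
  (\int[P]_t (`|(1 - s) *: V t + s *: (gradL (X t) (Y t) - gradf (X t))| ^+ 2)%:E
    <= ((1 - s) ^+ 2 * a + s ^+ 2 * sigma ^+ 2)%:E)%E.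
Proof.
move=> Va.
have [icross cross0] := averaging_orthogonal (le_lt_trans Va (ltry _)).
have mVT : strongly_measurable (V : T -> H).
  exact: (strongly_measurable_comp (measurable_id_sub GT) mV).
have mNT : strongly_measurable (fun t => N (t, Y t)).
  exact: (strongly_measurable_comp mpair mN).
have iV : P.-integrable setT (fun t => (`|V t| ^+ 2)%:E).
  apply/integrableP; split; first exact/measurable_EFinP/measurable_funX/measurable_norm.
  under eq_integral do rewrite gee0_abs ?lee_fin ?sqr_ge0//.
  exact: le_lt_trans Va (ltry _).
have iN : P.-integrable setT (fun t => (`|N (t, Y t)| ^+ 2)%:E).
  apply/integrableP; split; first exact/measurable_EFinP/measurable_funX/measurable_norm.
  under eq_integral do rewrite gee0_abs ?lee_fin ?sqr_ge0//.
  exact: le_lt_trans N_sqr (ltry _).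
have sqrE t : (`|(1 - s) *: V t + s *: N (t, Y t)| ^+ 2)%:E =
   (((1 - s) ^+ 2)%:E * (`|V t| ^+ 2)%:E + (s ^+ 2)%:E * (`|N (t, Y t)| ^+ 2)%:E
    + ((1 - s) * s)%:E * (2 * inner (V t) (N (t, Y t)))%:E)%E.
  rewrite -!EFinM -!EFinD normD_sqr innerZl innerZr !normrZ !exprMn !real_normK ?num_real//.
  by congr EFin; ring.
under eq_integral do rewrite sqrE.
rewrite integralD//; last 2 first.
- by apply: integrableD => //; exact: integrableZl.
- exact: integrableZl.
rewrite integralD//; try exact: integrableZl.
rewrite !integralZl// cross0 mule0 adde0 EFinD !EFinM.
by apply: leeD; apply: lee_wpmul2l => //; rewrite lee_fin sqr_ge0.
Qed.

End averaging.

(** * Scalar recursions *)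

Section recursion.
Context {R : realType}.

Lemma powR_mono (r x y : R) : 0 <= r -> 0 <= x -> x <= y -> x `^ r <= y `^ r.
Proof.
by move=> r0 x0 xy; rewrite ge0_ler_powR// nnegrE//; exact: le_trans xy.
Qed.

Lemma powR_le1 (r x : R) : 0 <= r -> 0 <= x <= 1 -> x `^ r <= 1.
Proof. by move=> r0 /andP[x0 x1]; have := powR_mono r0 x0 x1; rewrite powR1. Qed.

(** [(1 + x) `^ p <= exp (p x) <= 1 / (1 - p x)], and the last bound is at most
    [1 + y / 2] since [p x <= y / 4 <= 1 / 4]. *)
Lemma powR_1D_le (p x y : R) : 0 < p -> 0 <= x -> p * x <= y / 4 -> y <= 1 ->
  (1 + x) `^ p <= 1 + y / 2.
Proof.
move=> p0 x0 pxy y1.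
have x1 : 0 < 1 + x by rewrite ltr_wpDr.
rewrite /powR gt_eqF// (@le_trans _ _ (expR (y / 4)))//.
  rewrite ler_expR (le_trans _ pxy)// ler_pM2l// le_ln1Dx//.
  by rewrite (lt_le_trans _ x0)// ltrN10.
have e0 : 0 < expR (y / 4) by exact: expR_gt0.
have : 1 - y / 4 <= (expR (y / 4))^-1 by rewrite -expRN -(addrC (- _)) addrC expR_ge1Dx.
have y0 : 0 <= y by nra.
move=> h.
have : expR (y / 4) * (1 - y / 4) <= 1.
  by move: h; rewrite -(ler_pM2l e0) mulfV ?lt0r_neq0.
nra.
Qed.

(** The weight [gamma k `^ p] decreases so slowly that passing from [k] to
    [k + 1] costs a factor at most [1 + nu / 2], with
    [nu = gamma (k + 1) `^ alpha], while the recursion contracts by [1 - nu].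
    The remaining gain [nu / 2] absorbs the source term as soon as the multiple
    [M] of the weight is at least [2 c]. *)
Lemma recursion_bound (gamma a e : nat -> R) (alpha p c Mhi : R) :
  (forall k, 0 < gamma k <= 1) -> 0 < Mhi ->
  (forall k, gamma k / gamma k.+1 <= Mhi) -> 0 < alpha -> 0 < p -> 0 <= c ->
  (forall k, 0 <= a k) ->
  (forall k, a k.+1 <= (1 - gamma k.+1 `^ alpha) * a k +
                       c * gamma k.+1 `^ alpha * gamma k.+1 `^ p) ->
  e =o_\oo (fun k => gamma k `^ alpha) ->
  (\forall k \near \oo, gamma k / gamma k.+1 <= 1 + e k) ->
  exists2 M, 0 <= M & forall k, a k <= M * gamma k `^ p.
Proof.
move=> grange Mhi0 gratio al0 p0 c0 a0 arec /eqoP eo eslow.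
have g0 k : 0 < gamma k by case/andP: (grange k).
have g1 k : gamma k <= 1 by case/andP: (grange k).
have gp0 k q : 0 < gamma k `^ q by exact: powR_gt0.
have nu1 k : gamma k `^ alpha <= 1.
  by apply: powR_le1; [exact: ltW|rewrite (ltW (g0 k)) g1].
have Ma0 : 0 < Mhi `^ alpha by exact: powR_gt0.
(* This value makes [p * eps * gamma k `^ alpha] at most a quarter of
   [gamma k.+1 `^ alpha]. *)
pose eps := (4 * p * Mhi `^ alpha)^-1.
have eps0 : 0 < eps by rewrite invr_gt0 !mulr_gt0.
have nuM k : gamma k `^ alpha <= Mhi `^ alpha * gamma k.+1 `^ alpha.
  rewrite -powRM; [|exact: ltW..]; apply: powR_mono; [exact: ltW..|].
  by have := gratio k; rewrite ler_pdivrMr.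
have ratio_le : \forall k \near \oo,
    gamma k `^ p <= (1 + gamma k.+1 `^ alpha / 2) * gamma k.+1 `^ p.
  have := eo _ eps0; move: eslow; apply: filterS2 => k slow ek.
  rewrite -[X in X `^ p <= _](divfK (lt0r_neq0 (g0 k.+1))).
  rewrite powRM; [|by apply: ltW; rewrite ?divr_gt0..].
  apply: ler_wpM2r; first exact: ltW.
  apply: (@le_trans _ _ ((1 + eps * gamma k `^ alpha) `^ p)).
    apply: powR_mono; [exact: ltW|by rewrite ltW ?divr_gt0|].
    rewrite (le_trans slow)// lerD2l (le_trans (ler_norm _))// (le_trans ek)//.
    by rewrite ger0_norm// ltW.
  apply: powR_1D_le => //; first by rewrite mulr_ge0// ltW.
  rewrite (@le_trans _ _ (p * (eps * (Mhi `^ alpha * gamma k.+1 `^ alpha))))//.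
    by rewrite ler_pM2l// ler_pM2l.
  rewrite /eps le_eqVlt; apply/orP; left; apply/eqP; field.
  by rewrite !gt_eqF.
have [K _ hK] := ratio_le.
(* The sum dominates [a] on the initial segment, where the ratio bound may
   fail. *)
pose M := 2 * c + \sum_(k < K.+1) a k / gamma k `^ p.
have ag0 k : 0 <= a k / gamma k `^ p by apply: divr_ge0; [exact: a0|exact: ltW].
have sum0 (P : pred 'I_K.+1) : 0 <= \sum_(k < K.+1 | P k) a k / gamma k `^ p.
  by apply: sumr_ge0 => k _; exact: ag0.
have M0 : 0 <= M by rewrite addr_ge0 ?mulr_ge0.
exists M => //; elim => [|k IH].
  rewrite -ler_pdivrMr// /M big_ord_recl /= addrCA lerDl addr_ge0 ?mulr_ge0//.
  by apply: sumr_ge0 => k _; exact: ag0.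
have [kK|Kk] := ltnP k K.
  have kK1 : (k.+1 < K.+1)%N by [].
  rewrite -ler_pdivrMr// /M (bigD1 (Ordinal kK1))//= addrCA lerDl.
  by rewrite addr_ge0 ?mulr_ge0.
have h := hK k Kk; have nu0 := gp0 k.+1 alpha; have w0 := gp0 k.+1 p.
have nule1 := nu1 k.+1; have := arec k.
move: nu0 nule1 w0 h; set nu := gamma k.+1 `^ alpha; set w := gamma k.+1 `^ p.
move=> nu0 nule1 w0 h /le_trans; apply.
have Mc : 2 * c <= M by rewrite /M lerDl.
apply: (@le_trans _ _ ((1 - nu) * (M * ((1 + nu / 2) * w)) + c * nu * w)).
  rewrite lerD2r; apply: ler_wpM2l; first by rewrite subr_ge0.
  by rewrite (le_trans IH)// ler_wpM2l.
rewrite -subr_ge0.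
have -> : M * w - ((1 - nu) * (M * ((1 + nu / 2) * w)) + c * nu * w) =
  w * nu * ((M - 2 * c) / 2 + M * nu / 2) by field.
apply: mulr_ge0; first by rewrite ltW// mulr_gt0.
by apply: addr_ge0; rewrite divr_ge0 ?subr_ge0// mulr_ge0// ltW.
Qed.

(** The first summand comes from the drift of the gradient and is of order
    [g `^ (2 tau - alpha)], the second from the noise and is of order
    [g `^ (2 alpha)].  Dividing by the contraction rate [g `^ alpha] leaves the
    exponents [2 (tau - alpha)] and [alpha], both at least [2 m]. *)
Lemma source_term_le (g alpha tau B sigma m : R) : 0 < g <= 1 ->
  m <= alpha / 2 -> m <= tau - alpha ->
  (B * g `^ tau) ^+ 2 / g `^ alpha + (g `^ alpha) ^+ 2 * sigma ^+ 2 <=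
  (B ^+ 2 + sigma ^+ 2) * g `^ alpha * g `^ (m + m).
Proof.
move=> /andP[g0 g1] mal mtau.
have gN0 : g != 0 by rewrite gt_eqF.
have gD r s : g `^ (r + s) = g `^ r * g `^ s by rewrite powRD// gN0 implybT.
have gm r : m <= r -> g `^ r <= g `^ m by move=> mr; rewrite ger_powR// g0.
have gp r : 0 < g `^ r by exact: powR_gt0.
have m1 : (g `^ (alpha / 2)) ^+ 2 <= (g `^ m) ^+ 2.
  by rewrite ler_pXn2r ?nnegrE ?(ltW (gp _))// gm.
have m2 : (g `^ (tau - alpha)) ^+ 2 <= (g `^ m) ^+ 2.
  by rewrite ler_pXn2r ?nnegrE ?(ltW (gp _))// gm.
have alE : g `^ alpha = (g `^ (alpha / 2)) ^+ 2 by rewrite expr2 -gD -splitr.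
have tauE : g `^ tau = g `^ alpha * g `^ (tau - alpha) by rewrite -gD addrC subrK.
have h1 : (B * g `^ tau) ^+ 2 / g `^ alpha <= B ^+ 2 * g `^ alpha * (g `^ m) ^+ 2.
  rewrite tauE (_ : _ / _ = B ^+ 2 * g `^ alpha * (g `^ (tau - alpha)) ^+ 2).
    by apply: ler_wpM2l => //; rewrite mulr_ge0 ?sqr_ge0// ltW.
  by field; rewrite gt_eqF.
have h2 : (g `^ alpha) ^+ 2 * sigma ^+ 2 <= sigma ^+ 2 * g `^ alpha * (g `^ m) ^+ 2.
  rewrite (_ : _ * _ = sigma ^+ 2 * g `^ alpha * (g `^ (alpha / 2)) ^+ 2).
    by apply: ler_wpM2l => //; rewrite mulr_ge0 ?sqr_ge0// ltW.
  by rewrite -alE; ring.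
by rewrite gD -expr2 (le_trans (lerD h1 h2))// -!mulrDl.
Qed.

Lemma is_cvg_series_shift (u : nat -> R) :
  cvgn (series u) -> cvgn (series (fun k => u k.+1)).
Proof.
move=> cu.
have -> : series (fun k => u k.+1) = fun n => series u n.+1 - u 0%N.
  apply/funext => n; rewrite /series /= big_nat_recl//= addrAC subrr add0r.
  by rewrite !big_mkord.
by apply: is_cvgB; last exact: is_cvg_cst; apply: (cvgP (limn (series u))); rewrite cvg_shiftS.
Qed.

End recursion.

(** * Conditional expectations and almost sure summability *)

Section conditional_expectation.
Context {R : realType} d (T : measurableType d) (P : probability T R).
Variable G : set (set T).
Hypothesis GT : <<s G >> `<=` measurable.

Local Notation TG := (g_sigma_algebraType G).

Let idG : {mfun T >-> TG} := mfun_Sub (mem_set (measurable_id_sub GT)).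

(** The conditional expectation is the Radon-Nikodym derivative of
    [A |-> \int_A Y] with respect to [P], both restricted to [<<s G >>]. *)
Lemma cond_expectation_exists (Y : T -> R) : P.-integrable setT (EFin \o Y) ->
  exists Z, is_cond_expectation P <<s G >> Y Z.
Proof.
move=> iY.
pose nu := pushforward (induced_charge iY) (idG : T -> TG).
have numu : nu `<< distribution P idG.
  apply: dominates_pushforward => //.
  apply/null_content_dominatesP => A mA PA.
  apply: null_set_integral => //.
  by apply: measurable_funTS; have /integrableP[] := iY.
pose f0 := Radon_Nikodym nu (distribution P idG).
pose f := f0 (measurable_id_sub GT).
have ffin t : f t \is a fin_num by exact: Radon_Nikodym_fin_num.
have fE : EFin \o (fine \o f) = f by apply/funext => t /=; rewrite fineK.
have fint : (distribution P idG).-integrable setT f by exact: Radon_Nikodym_integrable.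
have mf : measurable_fun setT f by exact: measurable_int fint.
have fintP : P.-integrable setT (f \o idG).
  move/integrableP : fint => [_ foo]; apply/integrableP; split.
    exact: measurableT_comp.
  by move: foo; rewrite ge0_integral_distribution//; exact: measurableT_comp.
exists (fine \o f); split => //.
- by rewrite fE.
- move=> B mB.
  have mff : measurable_fun setT (fine \o f : TG -> R) by exact: measurableT_comp.
  by have := mff measurableT B mB; rewrite setTI.
- move=> A GA.
  have nuA : (nu A = \int[distribution P idG]_(t in A) f t)%E.
    exact: (Radon_Nikodym_integral numu GA).
  rewrite -[RHS]/(nu A) nuA integral_pushforward//.
    by apply: eq_integral => t _; rewrite /= fineK.
  by apply: (integrableS measurableT _ _ fintP) => //; exact: GT.
Qed.

(** The set where [Z < 0] belongs to [<<s G >>], so on it [`|Z|] integrates to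
    minus the integral of [Y], which is at most zero; on the complement [`|Z|]
    and [Y] have the same integral. *)
Lemma cond_expectation_norm_le (Y Z : T -> R) : (forall t, 0 <= Y t) ->
  is_cond_expectation P <<s G >> Y Z ->
  (\int[P]_t (`|Z t|)%:E <= \int[P]_t (Y t)%:E)%E.
Proof.
move=> Y0 [iY iZ mZ ZY].
have [mY mZT] : measurable_fun setT Y /\ measurable_fun setT Z.
  by split; apply/measurable_EFinP; [case/integrableP: iY|case/integrableP: iZ].
pose A := Z @^-1` `[0, +oo[; pose B := Z @^-1` `]-oo, 0[.
have GA : <<s G >> A by exact: mZ.
have GB : <<s G >> B by exact: mZ.
have [mA mB] : measurable A /\ measurable B by split; exact: GT.
have AB : A `|` B = setT.
  apply/seteqP; split => // t _; rewrite /A /B /= !in_itv/= andbT.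
  by case: (leP 0 (Z t)); [left|right].
have dAB : [disjoint A & B].
  apply/disj_setPS => t []; rewrite /A /B /= !in_itv/= andbT => h1 h2.
  by rewrite ltNge h1 in h2.
have mZn : measurable_fun setT (fun t => (`|Z t|)%:E).
  by apply/measurable_EFinP; exact: measurableT_comp.
rewrite -AB ge0_integral_setU//; last by rewrite AB.
have -> : (\int[P]_(t in A) (`|Z t|)%:E = \int[P]_(t in A) (Y t)%:E)%E.
  rewrite -ZY//; apply: eq_integral => t; rewrite inE /A /= in_itv/= andbT => t0.
  by rewrite ger0_norm.
have -> : (\int[P]_(t in B) (`|Z t|)%:E = - \int[P]_(t in B) (Y t)%:E)%E.
  rewrite -ZY// -integralN/=; last first.
    by apply: integrable_add_def => //; exact: (integrableS measurableT _ _ iZ).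
  apply: eq_integral => t; rewrite inE /B /= in_itv/= => t0.
  by rewrite ltr0_norm.
rewrite ge0_integral_setU//; last 2 first.
- by rewrite AB; exact/measurable_EFinP.
- by move=> t _; rewrite lee_fin.
have YB0 : (0 <= \int[P]_(t in B) (Y t)%:E)%E.
  by apply: integral_ge0 => t _; rewrite lee_fin.
apply: leeD => //; apply: (@le_trans _ _ 0%E) => //.
by rewrite oppe_le0.
Qed.

(** By monotone convergence the sum of the [`|Z k|] has finite expectation, so
    it is finite almost surely. *)
Lemma ae_summable (Z : nat -> T -> R) (b : nat -> R) :
  (forall k, measurable_fun setT (Z k)) -> (forall k, 0 <= b k) ->
  (forall k, \int[P]_t (`|Z k t|)%:E <= (b k)%:E)%E ->
  cvgn (series b) -> {ae P, forall t, cvgn (series (fun k => `|Z k t|))}.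
Proof.
move=> mZ b0 Zb cb.
have mZn k : measurable_fun setT (fun t => (`|Z k t|)%:E).
  by apply/measurable_EFinP; exact: measurableT_comp.
have Zn0 k t : setT t -> (0 <= (`|Z k t|)%:E)%E by rewrite lee_fin.
have sum_lty : (\int[P]_t (\sum_(k <oo) (`|Z k t|)%:E) < +oo)%E.
  rewrite integral_nneseries//.
  apply: (@le_lt_trans _ _ (limn (series b))%:E); last exact: ltry.
  apply: (@le_trans _ _ (\sum_(k <oo) (b k)%:E)%E).
    by apply: lee_nneseries => // k _ _; apply: integral_ge0.
  apply: lime_le; first by apply: is_cvg_nneseries => n _ _; rewrite lee_fin.
  apply: nearW => n; rewrite sumEFin lee_fin.
  by apply: nondecreasing_cvgn_le => //; apply: nondecreasing_series.
have sum0 t : (0 <= \sum_(k <oo) (`|Z k t|)%:E)%E.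
  by apply: nneseries_ge0 => n _ _; rewrite lee_fin.
have isum : P.-integrable setT (fun t => \sum_(k <oo) (`|Z k t|)%:E)%E.
  apply/integrableP; split; first by apply: ge0_emeasurable_sum.
  by under eq_integral do rewrite gee0_abs//.
have := integrable_ae measurableT isum; apply: filterS => t /(_ I) tfin.
apply: nondecreasing_is_cvgn; first by apply: nondecreasing_series.
exists (fine (\sum_(k <oo) (`|Z k t|)%:E)%E) => _ [n _ <-].
rewrite -lee_fin fineK// -sumEFin.
by apply: nneseries_lim_ge => k _ _; rewrite lee_fin.
Qed.

(** Integrate [Y <= w + Y ^ 2 / w]. *)
Lemma expectation_le_of_sqr (Y : T -> R) (M w : R) :
  measurable_fun setT Y -> (forall t, 0 <= Y t) -> 0 < w ->
  (\int[P]_t (Y t ^+ 2)%:E <= (M * w ^+ 2)%:E)%E ->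
  (\int[P]_t (Y t)%:E <= ((1 + M) * w)%:E)%E.
Proof.
move=> mY Y0 w0 Y2.
have mY2 : measurable_fun setT (fun t => (Y t ^+ 2)%:E).
  exact/measurable_EFinP/measurable_funX.
apply: (@le_trans _ _ (\int[P]_t (w%:E + (w^-1)%:E * (Y t ^+ 2)%:E))%E).
  apply: ge0_le_integral => //.
  - by move=> t _; rewrite lee_fin.
  - exact/measurable_EFinP.
  - by apply: emeasurable_funD => //; exact: measurable_funeM.
  - move=> t _; rewrite -EFinM -EFinD lee_fin -subr_ge0.
    rewrite (_ : _ - _ = w^-1 * (3 / 4 * w ^+ 2 + (Y t - w / 2) ^+ 2)).
      by rewrite mulr_ge0 ?invr_ge0 ?(ltW w0)// addr_ge0 ?sqr_ge0// mulr_ge0 ?sqr_ge0.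
    by field; rewrite gt_eqF.
have wi0 : (0 <= (w^-1)%:E)%E by rewrite lee_fin invr_ge0 ltW.
rewrite ge0_integralD//; last 3 first.
- by move=> t _; rewrite lee_fin ltW.
- by move=> t _; rewrite mule_ge0// lee_fin sqr_ge0.
- exact: measurable_funeM.
rewrite ge0_integralZl//; last by move=> t _; rewrite lee_fin sqr_ge0.
rewrite integral_cst//= probability_setT mule1.
rewrite mulrDl mul1r [leRHS]EFinD; apply: leeD => //.
rewrite (_ : M * w = w^-1 * (M * w ^+ 2)); last by field; rewrite gt_eqF.
by rewrite [leRHS]EFinM; apply: lee_wpmul2l.
Qed.

End conditional_expectation.

(** * Iterates and mean square error *)

(** The sigma-algebra on the domain of the iterates is arbitrary here, because
    these measurability statements are needed for each past sigma-algebra. *)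
Section iterates.
Context {R : realType} {H : hilbertType R}.
Context d (T : measurableType d) d' (E : measurableType d').
Variables (gradL : H -> E -> H) (gamma nu : nat -> R) (etas : nat -> T -> E).
Variables x s ghat : nat -> T -> H.
Hypothesis gradL_meas : jointly_measurable gradL.
Hypothesis x_rec : forall k w, x k.+1 w = x k w - gamma k *: (x k w - s k w).
Hypothesis ghat_rec : forall k w, ghat k w =
  (1 - nu k) *: (if k is j.+1 then ghat j w else 0)
  + nu k *: gradL (x k w) (etas k w).

Lemma measurable_iterate k : strongly_measurable (x 0%N) ->
  (forall i, (i < k)%N -> strongly_measurable (s i)) -> strongly_measurable (x k).
Proof.
move=> mx0; elim: k => // k IH ms.
have -> : x k.+1 = fun w => x k w - gamma k *: (x k w - s k w).
  by apply/funext => w; exact: x_rec.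
have mxk : strongly_measurable (x k) by apply: IH => i ik; apply: ms; exact: ltnW.
apply: strongly_measurableB => //; apply: strongly_measurableZ.
by apply: strongly_measurableB => //; exact: ms.
Qed.

Lemma measurable_average k : strongly_measurable (x 0%N) ->
  (forall i, (i < k)%N -> strongly_measurable (s i)) ->
  (forall i, (i < k)%N -> measurable_fun setT (etas i)) ->
  strongly_measurable (fun w => if k is j.+1 then ghat j w else 0).
Proof.
move=> mx0; elim: k => [|k IH] ms me; first exact: strongly_measurable_cst.
under eq_fun do rewrite ghat_rec.
have mxk : strongly_measurable (x k).
  by apply: measurable_iterate => // i ik; apply: ms; exact: ltnW.
apply: strongly_measurableD; apply: strongly_measurableZ.
  by apply: IH => i ik; [apply: ms|apply: me]; exact: ltnW.
by apply: gradL_meas => //; exact: me.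
Qed.

End iterates.

Lemma iterate_in (R : realType) (H : hilbertType R) (C : set H) (T : Type)
    (gamma : nat -> R) (x s : nat -> T -> H) :
  convex_set C -> (forall k, 0 < gamma k <= 1) ->
  (forall k w, x k.+1 w = x k w - gamma k *: (x k w - s k w)) ->
  (forall w, C (x 0%N w)) -> (forall k w, C (s k w)) -> forall k w, C (x k w).
Proof.
move=> cC grange x_rec Cx0 Cs; elim=> // k IH w.
have /andP[/ltW g0 g1] := grange k.
have := cC (s k w) (x k w) (Itv01 g0 g1).
rewrite !inE => /(_ (Cs k w) (IH w)).
rewrite x_rec; congr C.
rewrite /conv /= -[unstable.onem _]/(1 - gamma k) scalerBl scale1r scalerBr opprB.
by rewrite addrCA.
Qed.

Lemma hoelder_continuous (R : realType) (H K : hilbertType R) (g : H -> K)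
    (c t : R) : 0 < c -> 0 < t ->
  (forall x y, `|g x - g y| <= c * `|x - y| `^ t) -> continuous g.
Proof.
move=> c0 t0 hg x; apply/cvgrPdist_lt => e e0.
have ec : 0 < e / c by rewrite divr_gt0.
have : \forall y \near x, `|x - y| < (e / c) `^ t^-1.
  by apply/nbhs_normP; exists ((e / c) `^ t^-1) => //=; exact: powR_gt0.
apply: filterS => y xy; apply: (le_lt_trans (hg x y)).
rewrite mulrC -ltr_pdivlMr//.
have -> : e / c = ((e / c) `^ t^-1) `^ t.
  by rewrite -powRrM mulVf ?gt_eqF// powRr1// ltW.
by rewrite gt0_ltr_powR// nnegrE// ltW// powR_gt0.
Qed.

Section error.
Context {R : realType} {H : hilbertType R}.
Context d (T : measurableType d) d' (E : measurableType d').
Variables (P : probability T R) (G : nat -> set (set T)).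
Hypothesis GT : forall k, <<s G k >> `<=` measurable.
Variables (eta : T -> E) (etas : nat -> T -> E).
Hypotheses (meta : measurable_fun setT eta).
Hypotheses (metas : forall k, measurable_fun setT (etas k)).
Hypothesis etas_law :
  forall k B, measurable B -> P (etas k @^-1` B) = P (eta @^-1` B).
Hypothesis etas_fresh : forall k, independent_of P <<s G k >> (etas k).
Variables (C : set H) (gradL : H -> E -> H) (gradf : H -> H) (sigma : R).
Hypothesis gradL_meas : jointly_measurable gradL.
Hypothesis gradf_cont : continuous gradf.
Hypothesis gradf_expectation :
  forall x, is_bochner_expectation P (fun t => gradL x (eta t)) (gradf x).
Hypothesis variance : forall x, C x ->
  ('E_P[fun t => (`|gradL x (eta t) - gradf x| ^+ 2)%R] <= (sigma ^+ 2)%:E)%E.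
Variables (nu : nat -> R) (x ghat : nat -> T -> H).
Hypothesis nu_range : forall k, 0 < nu k <= 1.
Let prev k w := if k is j.+1 then ghat j w else 0.
Hypothesis ghat_rec : forall k w, ghat k w =
  (1 - nu k) *: prev k w + nu k *: gradL (x k w) (etas k w).
Hypothesis mx : forall k, strongly_measurable (x k : g_sigma_algebraType (G k) -> H).
Hypothesis mprev :
  forall k, strongly_measurable (prev k : g_sigma_algebraType (G k) -> H).
Hypothesis Cx : forall k w, C (x k w).

Let lambda k w := ghat k w - gradf (x k w).

Lemma measurable_error k : strongly_measurable (lambda k).
Proof.
apply: strongly_measurableB.
  exact: (strongly_measurable_comp (measurable_id_sub (@GT k.+1)) (mprev k.+1)).
apply: (strongly_measurable_continuous gradf_cont).
exact: (strongly_measurable_comp (measurable_id_sub (@GT k)) (mx k)).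
Qed.

Lemma error_average k (a : R) :
  (\int[P]_w (`|prev k w - gradf (x k w)| ^+ 2)%:E <= a%:E)%E ->
  (\int[P]_w (`|lambda k w| ^+ 2)%:E <=
    ((1 - nu k) ^+ 2 * a + nu k ^+ 2 * sigma ^+ 2)%:E)%E.
Proof.
move=> Va.
have mV : strongly_measurable
    ((fun w => prev k w - gradf (x k w)) : g_sigma_algebraType (G k) -> H).
  apply: strongly_measurableB; first exact: mprev.
  exact: (strongly_measurable_continuous gradf_cont (mx k)).
have := averaging_step (@GT k) meta (metas k) (@etas_law k) (@etas_fresh k)
  gradL_meas gradf_cont gradf_expectation variance (mx k) mV (Cx k) (nu k) Va.
congr (_ <= _)%E; apply: eq_integral => w _; congr (`|_| ^+ 2)%:E.
rewrite /lambda ghat_rec !scalerBr addrACA; congr (_ + _).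
by rewrite -opprD -scalerDl subrK scale1r.
Qed.

(** Before the first sample the average is [0], so the past term is
    [- gradf (x 0)]. *)
Lemma error_init (r : R) : (forall w, `|gradf (x 0%N w)| ^+ 2 <= r) ->
  (\int[P]_w (`|lambda 0 w| ^+ 2)%:E <=
    ((1 - nu 0) ^+ 2 * r + nu 0 ^+ 2 * sigma ^+ 2)%:E)%E.
Proof.
move=> gr; apply: error_average.
apply: (@le_trans _ _ (\int[P]_w r%:E)%E); last first.
  by rewrite integral_cst//= probability_setT mule1.
have mg : strongly_measurable (gradf \o x 0%N : T -> H).
  apply: (strongly_measurable_continuous gradf_cont).
  exact: (strongly_measurable_comp (measurable_id_sub (@GT 0)) (mx 0)).
apply: ge0_le_integral => //.
- apply/measurable_EFinP/measurable_funX; under eq_fun do rewrite /prev sub0r normrN.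
  exact: measurable_norm mg.
- by move=> w _; rewrite /prev sub0r normrN lee_fin.
Qed.

(** With [t = nu (k + 1)], Young's inequality replaces the past term by
    [(1 + t) a + (1 + 1 / t) r], where [r] bounds the squared drift of the
    gradient, and the factor [(1 - t) ^ 2] turns the two coefficients into
    [1 - t] and [1 / t]. *)
Lemma error_step k (a r : R) :
  (forall w, `|gradf (x k w) - gradf (x k.+1 w)| ^+ 2 <= r) ->
  (\int[P]_w (`|lambda k w| ^+ 2)%:E <= a%:E)%E ->
  (\int[P]_w (`|lambda k.+1 w| ^+ 2)%:E <=
    ((1 - nu k.+1) * a + r / nu k.+1 + nu k.+1 ^+ 2 * sigma ^+ 2)%:E)%E.
Proof.
move=> gr la; have /andP[] := nu_range k.+1.
set t := nu k.+1 => t0 t1.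
have ti0 : 0 < t^-1 by rewrite invr_gt0.
have r0 : 0 <= r by apply: le_trans (gr point); exact: sqr_ge0.
have a0 : 0 <= a.
  by rewrite -lee_fin; apply: le_trans la; apply: integral_ge0 => w _; rewrite lee_fin sqr_ge0.
have ml : measurable_fun setT (fun w => (`|lambda k w| ^+ 2)%:E).
  exact/measurable_EFinP/measurable_funX/measurable_norm/measurable_error.
have mV : strongly_measurable (fun w => prev k.+1 w - gradf (x k.+1 w)).
  apply: strongly_measurableB.
    exact: (strongly_measurable_comp (measurable_id_sub (@GT k.+1)) (mprev k.+1)).
  apply: (strongly_measurable_continuous gradf_cont).
  exact: (strongly_measurable_comp (measurable_id_sub (@GT k.+1)) (mx k.+1)).
have Va : (\int[P]_w (`|prev k.+1 w - gradf (x k.+1 w)| ^+ 2)%:E <=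
    ((1 + t) * a + (1 + t^-1) * r)%:E)%E.
  apply: (@le_trans _ _ (\int[P]_w ((1 + t)%:E * (`|lambda k w| ^+ 2)%:E +
                                   ((1 + t^-1) * r)%:E))%E).
    apply: ge0_le_integral => //.
    - exact/measurable_EFinP/measurable_funX/measurable_norm.
    - by apply: emeasurable_funD => //; exact: measurable_funeM.
    - move=> w _; rewrite -EFinM -EFinD lee_fin.
      rewrite -[_ - _](subrKA (gradf (x k w))).
      apply: (le_trans (normD_young _ _ t0)); rewrite lerD2l ler_wpM2l ?gr//.
      by rewrite addr_ge0// ltW.
  rewrite ge0_integralD//; last 3 first.
  - by move=> w _; rewrite -EFinM lee_fin mulr_ge0 ?sqr_ge0// addr_ge0// ltW.
  - exact: measurable_funeM.
  - by move=> w _; rewrite lee_fin mulr_ge0// addr_ge0// ltW.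
  rewrite ge0_integralZl//; last by rewrite lee_fin addr_ge0// ltW.
  rewrite integral_cst//= probability_setT mule1 [leRHS]EFinD.
  by apply: leeD => //; rewrite EFinM; apply: lee_wpmul2l => //; rewrite lee_fin addr_ge0// ltW.
apply: le_trans (error_average Va) _; rewrite lee_fin lerD2r -/t.
rewrite -subr_ge0.
have -> : (1 - t) * a + r / t - (1 - t) ^+ 2 * ((1 + t) * a + (1 + t^-1) * r) =
   t ^+ 2 * (1 - t) * a + r * (1 + t * (1 - t)) by field; rewrite gt_eqF.
apply: addr_ge0; apply: mulr_ge0 => //.
  by apply: mulr_ge0; rewrite ?sqr_ge0 ?subr_ge0.
by apply: addr_ge0 => //; apply: mulr_ge0; rewrite ?subr_ge0// ltW.
Qed.

End error.

(** * Summability of the gradient error *)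

Section past.
Context {R : realType} {H K : hilbertType R}.
Context d (T : measurableType d) d' (E : measurableType d').

Lemma sub_measurable_generated (G : set (set T)) :
  G `<=` measurable -> <<s G >> `<=` measurable.
Proof.
by move=> GT; apply: smallest_sub => //; exact: sigma_algebra_measurable.
Qed.

Lemma event_generators_measurable (x0 : T -> H) (mu0 : T -> K)
    (s : nat -> T -> H) k : strongly_measurable x0 -> strongly_measurable mu0 ->
  (forall i, strongly_measurable (s i)) ->
  event_generators x0 mu0 s k `<=` measurable.
Proof.
move=> mx0 mmu0 ms A [[|]|[i _]] [U oU <-]; rewrite setTI;
  exact: strongly_measurable_open.
Qed.

End past.

Theorem proposition5p6 (R : realType) (H K : hilbertType R)
  (* the problem *)
  (C : set H) (A : {linear H -> K}) (Astar : K -> H) (b : K)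
  (d : measure_display) (Omega : measurableType d) (P : probability Omega R)
  (d' : measure_display) (E : measurableType d') (eta : Omega -> E)
  (L : H -> E -> R) (gradL : H -> E -> H) (f : H -> R) (gradf : H -> H)
  (C_convex : convex_set C) (C_wcompact : weakly_compact C)
  (A_bounded : bounded_operator A) (A_adjoint : is_adjoint A Astar)
  (b_ran : range A b)
  (eta_meas : measurable_fun setT eta)
  (L_grad : forall x e, is_gradient (L ^~ e) x (gradL x e))
  (gradL_meas : jointly_measurable gradL)
  (L_integrable : forall x, P.-integrable setT (EFin \o (L x \o eta)))
  (f_def : forall x, (f x)%:E = 'E_P[L x \o eta]%E)
  (f_grad : forall x, is_gradient f x (gradf x))
  (gradf_expectation : forall x, is_bochner_expectation P (fun w => gradL x (eta w)) (gradf x))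
  (Cf tau : R) (Cf_gt0 : 0 < Cf) (tau_gt0 : 0 < tau)
  (gradf_hoelder : forall x y, `|gradf x - gradf y| <= Cf * `|x - y| `^ tau)
  (* finite variance of the stochastic gradient, uniformly on C *)
  (sigma : R)
  (variance : forall x, C x ->
     ('E_P[fun w => (`|gradL x (eta w) - gradf x| ^+ 2)%R] <= (sigma ^+ 2)%:E)%E)
  (* the iteration *)
  (gamma rho theta nu : nat -> R) (etas : nat -> Omega -> E)
  (x s z ghat : nat -> Omega -> H) (mu : nat -> Omega -> K)
  (lambda_s : nat -> Omega -> R)
  (gamma_range : forall k, 0 < gamma k <= 1)
  (rho_ge0 : forall k, 0 <= rho k) (theta_ge0 : forall k, 0 <= theta k)
  (etas_meas : forall k, measurable_fun setT (etas k))
  (x0_meas : strongly_measurable (x 0%N))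
  (mu0_meas : strongly_measurable (mu 0%N))
  (s_meas : forall k, strongly_measurable (s k))
  (etas_iid : iid_copies P eta etas)
  (etas_fresh : forall k, independent_of P (past (x 0%N) (mu 0%N) s etas k) (etas k))
  (x0_C : forall w, C (x 0%N w))
  (mu0_ran : forall w, range A (mu 0%N w))
  (ghat_rec : forall k w,
     ghat k w = (1 - nu k) *: (if k is j.+1 then ghat j w else 0)
                + nu k *: gradL (x k w) (etas k w))
  (z_def : forall k w,
     z k w = ghat k w + Astar (mu k w) + rho k *: Astar (A (x k w) - b))
  (lambda_s_ge0 : forall k w, 0 <= lambda_s k w)
  (s_C : forall k w, C (s k w))
  (s_min : forall k w y, C y ->
     inner (z k w) (s k w) <= inner (z k w) y + lambda_s k w)
  (x_rec : forall k w, x k.+1 w = x k w - gamma k *: (x k w - s k w))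
  (mu_rec : forall k w, mu k.+1 w = mu k w + theta k *: (A (x k.+1 w) - b))
  (* standing step-size assumption *)
  (Mlo Mhi : R) (Mlo_gt0 : 0 < Mlo) (Mhi_gt0 : 0 < Mhi)
  (gamma_ratio : forall k, Mlo <= gamma k / gamma k.+1 <= Mhi)
  (* weights and conditions on the step sizes *)
  (alpha : R) (alpha_range : 0 < alpha < tau)
  (nu_def : forall k, nu k = gamma k `^ alpha)
  (gamma_summable :
     cvgn (series (fun k => gamma k `^ (1 + Num.min (alpha / 2) (tau - alpha)))))
  (gamma_slow : exists2 e : nat -> R,
     e =o_\oo (fun k => gamma k `^ alpha) &
     \forall k \near \oo, gamma k / gamma k.+1 <= 1 + e k) :
  let S := filtration (x 0%N) (mu 0%N) s in
  let lambda k w := ghat k w - gradf (x k w) in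
  (exists Z : nat -> Omega -> R,
     forall k, is_cond_expectation P (S k) (fun w => `|lambda k.+1 w|) (Z k)) /\
  (forall Z : nat -> Omega -> R,
     (forall k, is_cond_expectation P (S k) (fun w => `|lambda k.+1 w|) (Z k)) ->
     ell1 P S (fun k w => gamma k.+1 * Z k w)).
Proof.
move=> S lambda.
have g0 k : 0 < gamma k by case/andP: (gamma_range k).
have g1 k : gamma k <= 1 by case/andP: (gamma_range k).
have /andP[al0 altau] := alpha_range.
have nu_range k : 0 < nu k <= 1.
  rewrite nu_def powR_gt0//=; apply: powR_le1; first exact: ltW.
  by rewrite (ltW (g0 k)) g1.
have [M CM] := weakly_compact_bounded C_wcompact.
have Cx := iterate_in C_convex gamma_range x_rec x0_C s_C.
have gradf_cont : continuous gradf := hoelder_continuous Cf_gt0 tau_gt0 gradf_hoelder.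
pose G k := event_generators (x 0%N) (mu 0%N) s k `|`
  \bigcup_(i in `I_k) preimage_set_system setT (etas i) measurable.
have GT k : <<s G k >> `<=` measurable.
  apply: sub_measurable_generated => Q [|[i _ [B mB <-]]].
    exact: event_generators_measurable.
  by apply: etas_meas.
have ST k : S k `<=` measurable.
  by apply: sub_measurable_generated => Q; exact: event_generators_measurable.
have mx0G k : strongly_measurable (x 0%N : g_sigma_algebraType (G k) -> H).
  apply: strongly_measurable_sub => // U oU; apply: sub_sigma_algebra.
  by left; left; left; exists U => //; rewrite setTI.
have msG k i : (i < k)%N -> strongly_measurable (s i : g_sigma_algebraType (G k) -> H).
  move=> ik; apply: strongly_measurable_sub => // U oU; apply: sub_sigma_algebra.
  by left; right; exists i => //; exists U => //; rewrite setTI.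
have metasG k i : (i < k)%N ->
    measurable_fun setT (etas i : g_sigma_algebraType (G k) -> E).
  move=> ik _ B mB; apply: sub_sigma_algebra.
  by right; exists i => //; exists B.
have mx k : strongly_measurable (x k : g_sigma_algebraType (G k) -> H).
  exact: (@measurable_iterate _ _ _ (g_sigma_algebraType (G k)) gamma x s x_rec
    k (mx0G k) (msG k)).
have mprev k : strongly_measurable
    ((fun w => if k is j.+1 then ghat j w else 0) : g_sigma_algebraType (G k) -> H).
  exact: (@measurable_average _ _ _ (g_sigma_algebraType (G k)) _ _ gradL gamma nu
    etas x s ghat gradL_meas x_rec ghat_rec k (mx0G k) (msG k) (metasG k)).
have mlambda k : strongly_measurable (lambda k).
  exact: (measurable_error GT gradf_cont mx mprev).
(* [2 * M] bounds the diameter of [C], hence the length of [x k - s k]; [Mhi]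
   replaces [gamma k] by [gamma k.+1]. *)
have M0 : 0 <= M by apply: le_trans (CM _ (x0_C point)).
pose B := Cf * (2 * M * Mhi) `^ tau.
pose D := `|gradf (x 0%N point)| + Cf * (2 * M) `^ tau.
have gradf0 w : `|gradf (x 0%N w)| ^+ 2 <= D ^+ 2.
  rewrite ler_pXn2r ?nnegrE//; last by rewrite addr_ge0// mulr_ge0 ?powR_ge0// ltW.
  rewrite -[gradf (x 0%N w)](subrK (gradf (x 0%N point))) addrC.
  rewrite (le_trans (ler_normD _ _))// lerD2l (le_trans (gradf_hoelder _ _))//.
  rewrite ler_pM2l// powR_mono ?(ltW tau_gt0)//.
  by rewrite (le_trans (ler_normB _ _))// mulr2n mulrDl !mul1r lerD// CM.
have gradf_step k w :
    `|gradf (x k w) - gradf (x k.+1 w)| ^+ 2 <= (B * gamma k.+1 `^ tau) ^+ 2.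
  rewrite ler_pXn2r ?nnegrE ?mulr_ge0 ?powR_ge0 ?(ltW Cf_gt0)//.
  rewrite (le_trans (gradf_hoelder _ _))// /B -mulrA ler_pM2l//.
  rewrite -powRM ?(ltW (g0 _)) ?mulr_ge0 ?(ltW Mhi_gt0)//.
  rewrite powR_mono ?(ltW tau_gt0)//.
  rewrite x_rec opprB addrC subrK normrZ gtr0_norm//.
  have gM : gamma k <= Mhi * gamma k.+1.
    by have /andP[_] := gamma_ratio k; rewrite ler_pdivrMr.
  rewrite -mulrA mulrC ler_pM ?(ltW (g0 _))//.
  by rewrite (le_trans (ler_normB _ _))// mulr2n mulrDl !mul1r lerD// CM.
pose Esqr k := (\int[P]_w (`|lambda k w| ^+ 2)%:E)%E.
pose m := Num.min (alpha / 2) (tau - alpha).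
pose c := B ^+ 2 + sigma ^+ 2.
have law k A' : measurable A' -> P (etas k @^-1` A') = P (eta @^-1` A').
  by move=> mA; apply: etas_iid.1.
have Estep k (a : R) : (Esqr k <= a%:E)%E -> (Esqr k.+1 <=
    ((1 - gamma k.+1 `^ alpha) * a +
     c * gamma k.+1 `^ alpha * gamma k.+1 `^ (m + m))%:E)%E.
  move=> Ea.
  have := error_step GT eta_meas etas_meas law etas_fresh gradL_meas gradf_cont
    gradf_expectation variance nu_range ghat_rec mx mprev Cx (gradf_step k) Ea.
  move=> /le_trans; apply; rewrite lee_fin nu_def -addrA lerD2l.
  by apply: source_term_le => //; rewrite /m ge_min lexx ?orbT.
have Esqr0 k : (0 <= Esqr k)%E by apply: integral_ge0 => w _; rewrite lee_fin sqr_ge0.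
have Efin k : Esqr k \is a fin_num.
  rewrite ge0_fin_numE//; elim: k => [|k].
    have := error_init GT eta_meas etas_meas law etas_fresh gradL_meas gradf_cont
      gradf_expectation variance ghat_rec mx mprev Cx gradf0.
    by move=> /le_lt_trans; apply; exact: ltry.
  rewrite -ge0_fin_numE// => Ek.
  by apply: (@le_lt_trans _ _ _ _ _ (Estep k (fine (Esqr k)) _) (ltry _)); rewrite fineK.
have m0 : 0 < m by rewrite /m lt_min divr_gt0// subr_gt0.
have [e elit eslow] := gamma_slow.
(* Finiteness of the mean square errors lets the recursion be read on real
   numbers. *)
have [Me Me0 aM] : exists2 Me, 0 <= Me &
    forall k, fine (Esqr k) <= Me * gamma k `^ (m + m).
  apply: (@recursion_bound _ gamma _ e alpha (m + m) c Mhi) => //.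
  - by move=> k; case/andP: (gamma_ratio k).
  - exact: addr_gt0.
  - by rewrite addr_ge0 ?sqr_ge0.
  - by move=> k; exact: fine_ge0.
  - by move=> k; rewrite -lee_fin fineK//; apply: Estep; rewrite fineK.
have lambda_norm k : (\int[P]_w (`|lambda k w|)%:E <=
    ((1 + Me) * gamma k `^ m)%:E)%E.
  apply: expectation_le_of_sqr => //.
  - exact: measurable_norm.
  - exact: powR_gt0.
  - rewrite -/(Esqr k) -(fineK (Efin k)) lee_fin (le_trans (aM k))//.
    by rewrite expr2 powRD// (gt_eqF (g0 k)) implybT.
have ilambda k : P.-integrable setT (fun w => (`|lambda k w|)%:E).
  apply/integrableP; split; first exact/measurable_EFinP/measurable_norm.
  under eq_integral do rewrite abse_EFin normr_id.
  exact: le_lt_trans (lambda_norm k) (ltry _).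
split.
  have /choice[Z ZS] k : exists Zk,
      is_cond_expectation P (S k) (fun w => `|lambda k.+1 w|) Zk.
    by apply: (cond_expectation_exists (ST k)); exact: ilambda.
  by exists Z.
move=> Z ZS; split.
  move=> k A' mA'; have [_ _ mZ _] := ZS k.
  apply: (mZ ((fun r => gamma k.+1 * r) @^-1` A')).
  have mg : measurable_fun setT (fun r : R => gamma k.+1 * r) by exact: measurable_funM.
  by rewrite -[X in measurable X]setTI; exact: mg.
have mZ k : measurable_fun setT (Z k).
  by have [_ /integrableP[/measurable_EFinP]] := ZS k.
apply: (@ae_summable _ _ _ _ _ (fun k => (1 + Me) * gamma k.+1 `^ (1 + m))).
- by move=> k; apply: measurable_funM.
- by move=> k; rewrite mulr_ge0 ?powR_ge0// addr_ge0.
- move=> k.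
  have -> : (\int[P]_t (`|gamma k.+1 * Z k t|)%:E =
      (gamma k.+1)%:E * \int[P]_t (`|Z k t|)%:E)%E.
    rewrite -ge0_integralZl//; last 2 first.
    - by apply/measurable_EFinP; exact: measurableT_comp.
    - by rewrite lee_fin ltW.
    by apply: eq_integral => w _; rewrite normrM gtr0_norm.
  have h := cond_expectation_norm_le (ST k) (fun w => normr_ge0 _) (ZS k).
  have := le_trans h (lambda_norm k.+1).
  have gk0 : (0 <= (gamma k.+1)%:E)%E by rewrite lee_fin ltW.
  move=> /(lee_wpmul2l gk0)/le_trans; apply.
  rewrite -EFinM lee_fin mulrCA powRD; last by rewrite (gt_eqF (g0 _)) implybT.
  by rewrite powRr1// ltW.
- rewrite -[X in series X]/((1 + Me) *: (fun k => gamma k.+1 `^ (1 + m))).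
  exact: is_cvg_seriesZ (is_cvg_series_shift gamma_summable).
Qed.
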